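(* Let $\mathcal H$ be a finite-dimensional Hilbert space, and let $\mathcal C,\mathcal C'\subset\mathcal H$ be closed convex cones, each generating $\mathcal H$, with either $\mathcal C\subset\mathcal C'$ or $\mathcal C'\subset\mathcal C$. Suppose that $\mathsf H:\mathcal H\to\mathbb R$ is locally Lipschitz. Let $u$ be a viscosity subsolution of $\mathrm{HJ}(\mathcal H,\mathcal C,\mathsf H)$ and $v$ a viscosity supersolution of $\mathrm{HJ}(\mathcal H,\mathcal C',\mathsf H)$. Suppose that $$L=\sup_{t\in\mathbb R_+}\max\{\|u(t,\cdot)\|_{\mathrm{Lip}},\|v(t,\cdot)\|_{\mathrm{Lip}}\}$$ is finite. Then, for every $R>0$ and every $M>2L$, the function $$\mathbb R_+\times(\mathcal C\cap\mathcal C')\ni(t,x)\longmapsto u(t,x)-v(t,x)-M\big(|x|_{\mathcal H}+Vt-R\big)_+$$ achieves its global supremum on $\{0\}\times(\mathcal C\cap\mathcal C')$, where $$V=\sup\Big\{\frac{|\mathsf H(y)-\mathsf H(y')|}{|y-y'|_{\mathcal H}}:\ y\ne y',\ |y|_{\mathcal H},|y'|_{\mathcal H}\le 2L+3M\Big\}.$$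
   Context: $\mathbb R_+=[0,\infty)$; $a_+=\max\{a,0\}$. A closed convex cone $\mathcal C\subset\mathcal H$ generates $\mathcal H$ if the closure of $\mathcal C-\mathcal C$ is $\mathcal H$. $\|\cdot\|_{\mathrm{Lip}}$ is the best Lipschitz constant with respect to $|\cdot|_{\mathcal H}$ (on $\mathcal C$ for $u(t,\cdot)$, on $\mathcal C'$ for $v(t,\cdot)$). Viscosity solutions. Let $\mathcal D\subset\mathcal H$. A function $\phi:(0,\infty)\times\mathcal D\to\mathbb R$ is smooth if at every $(t,x)$ there is a unique $(\partial_t\phi(t,x),\nabla\phi(t,x))\in\mathbb R\times\mathcal H$ with $\phi(s,y)-\phi(t,x)=\partial_t\phi(t,x)(s-t)+\langle\nabla\phi(t,x),y-x\rangle_{\mathcal H}+o(|s-t|+|y-x|_{\mathcal H})$ as $(s,y)\to(t,x)$ in $(0,\infty)\times\mathcal D$, the error is in fact $O(|s-t|^2+|y-x|_{\mathcal H}^2)$ at every point, and $(t,x)\mapsto(\partial_t\phi,\nabla\phi)$ is continuous. A continuous $f:\mathbb R_+\times\mathcal D\to\mathbb R$ is a viscosity subsolution (resp. supersolution) of $\mathrm{HJ}(\mathcal H,\mathcal D,\mathsf H)$ (the equation $\partial_tf-\mathsf H(\nabla f)=0$ on $\mathbb R_+\times\mathcal D$) if for every $(t,x)\in(0,\infty)\times\mathcal D$ (including boundary points of $\mathcal D$ belonging to $\mathcal D$) and every smooth $\phi$ such that $f-\phi$ has a local maximum (resp. minimum) at $(t,x)$ relative to $(0,\infty)\times\mathcal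 D$, one has $(\partial_t\phi-\mathsf H(\nabla\phi))(t,x)\le0$ (resp. $\ge0$). *)

(* Defs.v *)
From HB Require Import structures.
From mathcomp Require Import all_boot all_order all_algebra.
From mathcomp Require Import all_classical all_reals all_analysis.

Set Implicit Arguments.
Unset Strict Implicit.
Unset Printing Implicit Defensive.

Import Order.TTheory GRing.Theory Num.Theory.
Import numFieldNormedType.Exports.

Local Open Scope classical_set_scope.
Local Open Scope ring_scope.

(* Completeness is not required as a field: it follows from the finite
   dimension provided by [Vector]. *)
HB.mixin Record isFinHilbert (R : realType) H
    of NormedModule R H & Vector R H := {
  dotp : {dot H for (@idfun R)} ;
  norm_dotp : forall x : H, `|x| = Num.sqrt (dotp x x)
}.

#[short(type="finHilbertType")]
HB.structure Definition FinHilbert (R : realType) :=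
  {H of NormedModule R H & Vector R H & isFinHilbert R H}.

Section Definitions.
Context {R : realType} {H : finHilbertType R}.

Definition closed_convex_cone (C : set H) : Prop :=
  [/\ closed C,
      convex_set (C : set (convex_lmodType H)) &
      forall (a : R) (x : H), 0 <= a -> C x -> C (a *: x)].

Definition generates (C : set H) : Prop :=
  closure [set x - y | x in C & y in C] = [set: H].

Definition locally_lipschitz (f : H -> R) : Prop :=
  forall x : H, exists2 U : set H, nbhs x U & [lipschitz f y | y in U].

(* The best Lipschitz constant of [f] on [D]; it is [+oo] if [f] is not
   Lipschitz on [D]. *)
Definition lip_norm (D : set H) (f : H -> R) : \bar R :=
  ereal_inf [set k%:E | k in [set k : R | 0 <= k /\ k.-lipschitz_D f]].

(* For [f] Lipschitz on bounded sets the quotients are bounded; if [H] is the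
   zero space there are none and [sup set0 = 0]. *)
Definition ball_lip (f : H -> R) (r : R) : R :=
  sup [set `|f p.1 - f p.2| / `|p.1 - p.2| |
        p in [set p : H * H | [/\ p.1 != p.2, `|p.1| <= r & `|p.2| <= r]]].

(* Functions on a time-space domain are total functions on [R * H], of which
   only the values on the domain are ever used. *)
Definition nonneg_time (D : set H) : set (R * H) :=
  [set z | 0 <= z.1 /\ D z.2].

Definition pos_time (D : set H) : set (R * H) :=
  [set z | 0 < z.1 /\ D z.2].

(* [d] is the pair (time derivative, gradient). *)
Definition taylor_error (phi : R * H -> R) (z d : R * H) : R * H -> R :=
  fun w => phi w - phi z - (d.1 * (w.1 - z.1) + dotp d.2 (w.2 - z.2)).

Definition expansion (D : set H) (phi : R * H -> R) (z d : R * H) : Prop :=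
  taylor_error phi z d =o_ (within (pos_time D) (nbhs z))
    (fun w : R * H => `|w.1 - z.1| + `|w.2 - z.2|).

(* [phi] is smooth on the positive times over [D], and [dphi] is its field of
   derivatives there. *)
Definition smooth (D : set H) (phi : R * H -> R) (dphi : R * H -> R * H)
    : Prop :=
  [/\ forall z, pos_time D z -> unique (expansion D phi z) (dphi z),
      forall z, pos_time D z ->
        taylor_error phi z (dphi z) =O_ (within (pos_time D) (nbhs z))
          (fun w : R * H => `|w.1 - z.1| ^+ 2 + `|w.2 - z.2| ^+ 2) &
      {within pos_time D, continuous dphi}].

Definition local_max_on (A : set (R * H)) (f : R * H -> R) (z : R * H)
    : Prop :=
  \forall w \near within A (nbhs z), f w <= f z.

Definition local_min_on (A : set (R * H)) (f : R * H -> R) (z : R * H)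
    : Prop :=
  \forall w \near within A (nbhs z), f z <= f w.

Definition viscosity_subsolution (D : set H) (h : H -> R) (f : R * H -> R)
    : Prop :=
  {within nonneg_time D, continuous f} /\
  forall (phi : R * H -> R) (dphi : R * H -> R * H) (z : R * H),
    pos_time D z -> smooth D phi dphi ->
    local_max_on (pos_time D) (fun w => f w - phi w) z ->
    (dphi z).1 - h (dphi z).2 <= 0.

Definition viscosity_supersolution (D : set H) (h : H -> R) (f : R * H -> R)
    : Prop :=
  {within nonneg_time D, continuous f} /\
  forall (phi : R * H -> R) (dphi : R * H -> R * H) (z : R * H),
    pos_time D z -> smooth D phi dphi ->
    local_min_on (pos_time D) (fun w => f w - phi w) z ->
    0 <= (dphi z).1 - h (dphi z).2.

Definition lip_sup (C C' : set H) (u v : R * H -> R) : \bar R :=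
  ereal_sup [set maxe (lip_norm C (fun x => u (t, x)))
                      (lip_norm C' (fun x => v (t, x))) |
              t in [set t : R | 0 <= t]].

(* The maximum of [f] over [A] exists and is attained at some point of [B]. *)
Definition achieves_sup_on (A B : set (R * H)) (f : R * H -> R) : Prop :=
  exists2 z, (A `&` B) z & forall w, A w -> f w <= f z.

End Definitions.

(* Main.v *)
Require Import Defs.
From mathcomp Require Import all_boot all_order all_algebra.
From mathcomp Require Import all_classical all_reals all_analysis.
From mathcomp Require Import ring lra.

Import Order.TTheory GRing.Theory Num.Theory.
Import numFieldNormedType.Exports.

Local Open Scope classical_set_scope.
Local Open Scope ring_scope.

(** Doubling of variables.  Suppose that the function exceeds its maximum [m] at
time 0 somewhere at time [t0].  Replace [(|x| + V t - r)_+] by a C^{1,1}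
approximation, a composition of two functions of the form
[s |-> sqrt (d^2 + s^2)], and add the penalty [B theta (t - t0)], where [theta]
is the same approximation of the positive part.  Since [theta' > 0], this
penalty makes the final inequality strict, and for [B] large it keeps maxima away
from the time [t0 + 1]; since [M > 2 L], maxima also stay in a bounded set.  At
a maximum of the functional in the doubled variables, one of the two cones
contains both space points, so the Lipschitz bound in that space variable
gives [|p| <= 2 L + 2 M] for the doubling gradient [p].  Together with a barrier
gradient of norm at most [M] all gradients stay in the ball of radius
[2 L + 3 M], where [V] is a Lipschitz constant of [h]; as the time derivative
of the barrier is [V M theta'], the two viscosity inequalities contradict each
other. *)

(** * Geometry of the Hilbert space *)

Section InnerProduct.
Context {R : realType} {H : finHilbertType R}.
Implicit Types (x y z : H) (a : R).

Lemma dotpC x y : dotp x y = dotp y x.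
Proof. by rewrite (hermC (dotp : {dot H for _})) /= expr0 mul1r. Qed.

Lemma dotpDl x y z : dotp (x + y) z = dotp x z + dotp y z.
Proof. exact: linearDl. Qed.

Lemma dotpDr x y z : dotp z (x + y) = dotp z x + dotp z y.
Proof. exact: linearDr. Qed.

Lemma dotpZl a x y : dotp (a *: x) y = a * dotp x y.
Proof. exact: linearZl_LR. Qed.

Lemma dotpZr a x y : dotp x (a *: y) = a * dotp x y.
Proof. by rewrite dotpC dotpZl dotpC. Qed.

Lemma dotpNl x y : dotp (- x) y = - dotp x y.
Proof. exact: linearNl. Qed.

Lemma dotpNr x y : dotp x (- y) = - dotp x y.
Proof. exact: linearNr. Qed.

Lemma dotp0r x : dotp x 0 = 0.
Proof. by rewrite -(scale0r (0 : H)) dotpZr mul0r. Qed.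

Lemma dotp0l x : dotp 0 x = 0.
Proof. by rewrite dotpC dotp0r. Qed.

Lemma dotpp x : dotp x x = `|x| ^+ 2.
Proof.
rewrite norm_dotp sqr_sqrtr//; have [->|x0] := eqVneq x 0.
  by rewrite dotp0l.
exact/ltW/neq0_dnorm_gt0.
Qed.

Lemma normB_sqr x y : `|x - y| ^+ 2 = `|x| ^+ 2 - 2 * dotp x y + `|y| ^+ 2.
Proof.
by rewrite -!dotpp dotpDl !dotpDr !dotpNl !dotpNr (dotpC y x); ring.
Qed.

Lemma cauchy_schwarz x y : `|dotp x y| <= `|x| * `|y|.
Proof.
wlog : x / 0 <= dotp x y => [hw|xy0].
  have [/hw//|/ltW xy0] := leP 0 (dotp x y).
  by rewrite -[leLHS]normrN -dotpNl -[`|x|]normrN hw// dotpNl oppr_ge0.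
rewrite ger0_norm//; have [->|y0] := eqVneq y 0.
  by rewrite dotp0r normr0 mulr0.
have [->|x0] := eqVneq x 0.
  by rewrite dotp0l normr0 mul0r.
have nx : 0 < `|x| by rewrite normr_gt0.
have ny : 0 < `|y| by rewrite normr_gt0.
(* Expanding this square gives [|x| |y|] times [|x| |y| - <x, y>], up to the factor 2. *)
have := sqr_ge0 `| `|y| *: x - `|x| *: y |.
rewrite normB_sqr !normrZ !normr_id dotpZl dotpZr => h.
have : 0 <= (`|x| * `|y|) * (`|x| * `|y| - dotp x y) by nra.
by rewrite pmulr_rge0 ?mulr_gt0// subr_ge0.
Qed.

Lemma dotp_le x y : dotp x y <= `|x| * `|y|.
Proof. exact: le_trans (ler_norm _) (cauchy_schwarz x y). Qed.

End InnerProduct.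

(** * Compactness of closed balls in finite dimension *)

Section Compactness.
Context {R : realType} {H : finHilbertType R}.

(** In coordinates [g] for a basis, [|g v|] attains a positive minimum [c] on the unit sphere, so
    [c |v| <= |g v|]. The ball is then the continuous image of a closed bounded set of coordinate
    vectors. *)
Lemma compact_closed_ball (rho : R) : compact [set x : H | `|x| <= rho].
Proof.
set n := (\dim {:H}); set e := vbasis {:H}.
have e_free : free e by exact: basis_free (vbasisP _).
pose g (v : 'rV[R]_n) : H := \sum_i v ord0 i *: e`_i.
have gZ a v : g (a *: v) = a *: g v.
  by rewrite /g scaler_sumr; apply: eq_bigr => i _; rewrite mxE scalerA.
have g_eq0 v : g v = 0 -> v = 0.
  move=> gv0; apply/rowP => i; rewrite mxE -(coord_sum_free (v ord0) i e_free).
  by rewrite -/(g v) gv0 linear0.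
have cg : continuous g.
  apply: continuous_big => [|i _]; first exact: add_continuous.
  move=> v; exact: (cvgZ (@coord_continuous R 1 n ord0 i v) (cvg_cst _)).
have cN : continuous (fun v : 'rV[R]_n => `|g v|).
  by move=> v; exact: (cvg_norm (cg v)).
pose S := [set v : 'rV[R]_n | `|v| = 1].
have cS : compact S.
  apply: bounded_closed_compact.
    by exists 1; split => // x x1 v Sv; apply: le_trans (ltW x1); rewrite -Sv.
  apply: (@closed_comp _ _ (fun v : 'rV[R]_n => `|v|) [set 1]).
    by move=> v _; exact: norm_continuous.
  exact: closed_eq.
have [c c0 hc] : exists2 c : R, 0 < c & forall v : 'rV[R]_n, c * `|v| <= `|g v|.
  (* The sphere is empty when [H] is the zero space; then every [v] is 0 and any [c] works. *)
  have [S0|/set0P S0] := eqVneq S set0.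
    exists 1 => // v; have [->|v0] := eqVneq v 0; first by rewrite normr0 mulr0.
    have : S (`|v|^-1 *: v).
      by rewrite /S /= normrZ normfV normr_id mulVf// normr_eq0.
    by rewrite S0.
  have [w wS hw] := compact_EVT_min S0 cS (continuous_subspaceT cN).
  exists `|g w|.
    rewrite normr_gt0; apply/eqP => /g_eq0 w0.
    by move: wS; rewrite inE /S /= w0 normr0 => /esym/eqP; rewrite oner_eq0.
  move=> v; have [->|v0] := eqVneq v 0; first by rewrite normr0 mulr0.
  have := hw (`|v|^-1 *: v).
  rewrite inE /S /= normrZ normfV normr_id mulVf ?normr_eq0//.
  move=> /(_ erefl); rewrite gZ normrZ normfV normr_id.
  by rewrite ler_pdivlMl ?normr_gt0// mulrC.
have -> : [set x : H | `|x| <= rho] =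
    g @` [set v : 'rV[R]_n | `|g v| <= rho].
  apply/seteqP; split => [x xr|_ [v vr <-]//].
  have xE : g (\row_i coord e i x) = x.
    rewrite [RHS](coord_vbasis (memvf x)).
    by apply: eq_bigr => i _; rewrite mxE.
  by exists (\row_i coord e i x); rewrite /= xE.
apply: continuous_compact.
  exact/continuous_subspaceT/cg.
apply: bounded_closed_compact.
  exists (rho / c); split; first exact: num_real.
  move=> x xr v /= vr; apply/ltW/(le_lt_trans _ xr).
  by rewrite ler_pdivlMr// mulrC (le_trans (hc v)).
apply: (@closed_comp _ _ (fun v : 'rV[R]_n => `|g v|) [set t | t <= rho]).
  by move=> v _; exact: cN.
exact: closed_le.
Qed.
End Compactness.

(** * From local Lipschitz continuity to a Lipschitz constant on balls *)

Section BallLip.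
Context {R : realType} {H : finHilbertType R}.

Lemma locally_lipschitz_nbhs (h : H -> R) (x : H) : locally_lipschitz h ->
  exists2 K : R, 0 <= K & exists2 U : set H, nbhs x U &
    forall k y z, K <= k -> U y -> U z -> `|h y - h z| <= k * `|y - z|.
Proof.
move=> /(_ x)[U Ux] [K [_ hK]]; exists (`|K| + 1).
  by rewrite addr_ge0.
exists U => // k y z Kk Uy Uz.
have /hK : K < k.
  by rewrite (lt_le_trans _ Kk)// (le_lt_trans (ler_norm _))// ltrDl.
by move=> /(_ (y, z)) /=; apply.
Qed.

(** Compactness of the set of pairs, with the constant tending to infinity: near a diagonal pair the
    local constant serves; near a pair of distinct points the distance stays away from 0 while the
    increment of [h] stays bounded. *)
Lemma locally_lipschitz_ball (h : H -> R) (rho : R) : locally_lipschitz h ->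
  exists K : R, forall x y, `|x| <= rho -> `|y| <= rho ->
    `|h x - h y| <= K * `|x - y|.
Proof.
move=> h_lip; have cB := @compact_closed_ball R H rho.
have /compact_near_coveringP nc := compact_setX cB cB.
have [|K [_ hK]] := nc R (nbhs +oo)
    (fun k p => `|h p.1 - h p.2| <= k * `|p.1 - p.2|) _.
  move=> [x y] _.
  have [K K0 [U Ux hU]] := locally_lipschitz_nbhs h x h_lip.
  have [<-|xy] := eqVneq x y.
    exists (U `*` U, [set k | K < k]).
      by split; [exists (U, U)|exists K; split => //; exact: num_real].
    move=> [[x' y'] k] [[Ux' Uy'] /ltW Kk]; exact: hU.
  have [K' K'0 [W Wy hW]] := locally_lipschitz_nbhs h y h_lip.
  set d := `|x - y|; have d0 : 0 < d by rewrite normr_gt0 subr_eq0.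
  have d3 : 0 < d / 3 by rewrite divr_gt0.
  pose A := ball x (d / 3); pose B := ball y (d / 3).
  (* Points of the two balls are at distance at least [d / 3]. Hence the first summand pays for
     [|h x - h y|], and the other two for the moves from [x] to [x'] and from [y] to [y'], each
     shorter than [d / 3]. *)
  exists ((U `&` A) `*` (W `&` B), [set k | 3 * `|h x - h y| / d + K + K' < k]).
    split; last first.
      by exists (3 * `|h x - h y| / d + K + K'); split => //; exact: num_real.
    exists (U `&` A, W `&` B) => //.
    by split; apply: filterI => //; exact: nbhsx_ballx.
  move=> [[x' y'] k] [/= [[Ux' Ax'] [Wy' By'] /ltW Kk]].
  have hx := hU K x x' (lexx _) (nbhs_singleton Ux) Ux'.
  have hy := hW K' y y' (lexx _) (nbhs_singleton Wy) Wy'.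
  rewrite /A /B -!ball_normE /ball_ /= in Ax' By'.
  have dd : d / 3 <= `|x' - y'|.
    have : d <= `|x - x'| + `|x' - y'| + `|y - y'|.
      have := ler_distD x' x y; have := ler_distD y' x' y.
      by rewrite [`|y' - y|]distrC /d; lra.
    lra.
  have : `|h x' - h y'| <= `|h x - h x'| + `|h x - h y| + `|h y - h y'|.
    have := ler_distD (h x) (h x') (h y'); have := ler_distD (h y) (h x) (h y').
    by rewrite [`|h x' - h x|]distrC; lra.
  have e0 : 0 <= `|h x - h y| by [].
  have : `|h x - h y| <= 3 * `|h x - h y| / d * `|x' - y'|.
    have E : 3 * `|h x - h y| / d * (d / 3) = `|h x - h y|.
      by field; rewrite gt_eqF.
    by rewrite -[leLHS]E ler_wpM2l// divr_ge0// ?mulr_ge0// ltW.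
  nra.
exists (K + 1) => x y xr yr.
by apply: (hK (K + 1) _ (x, y)) => //; rewrite ltrDl.
Qed.

Lemma ball_lipP (h : H -> R) (rho : R) (x y : H) : locally_lipschitz h ->
  `|x| <= rho -> `|y| <= rho -> `|h x - h y| <= ball_lip h rho * `|x - y|.
Proof.
move=> h_lip xr yr; have [->|xy] := eqVneq x y.
  by rewrite !subrr !normr0 mulr0.
have [K hK] := locally_lipschitz_ball h rho h_lip.
rewrite -ler_pdivrMr ?normr_gt0 ?subr_eq0//.
apply: ub_le_sup; last by exists (x, y).
exists K => _ [[x' y'] /= [x'y' x'r y'r] <-].
by rewrite ler_pdivrMr ?normr_gt0 ?subr_eq0// hK.
Qed.

Lemma ball_lip_ge0 (h : H -> R) (rho : R) : 0 <= ball_lip h rho.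
Proof.
rewrite /ball_lip; set E := [set _ | _ in _].
(* Without a supremum, [sup] takes the default value 0. *)
have [hE|/sup_out->//] := pselect (has_sup E).
have [[e Ee] _] := hE; apply: le_trans (sup_upper_bound hE Ee).
by case: Ee => p _ <-; rewrite divr_ge0.
Qed.
End BallLip.

(** * Smooth approximations of the norm and of the positive part *)

Section SmoothRoot.
Context {R : realType}.
Implicit Types (d a b c s : R).

(** The argument [a] stands for a square, [s^2] or [|x|^2], so that the positive part and the norm
    share the same estimates. *)
Definition sqrt_shift d a := Num.sqrt (d ^+ 2 + a).

Lemma sqrt_shift_ge d a : 0 < d -> 0 <= a -> d <= sqrt_shift d a.
Proof.
move=> d0 a0; have {1}<- : Num.sqrt (d ^+ 2) = d by rewrite sqrtr_sqr gtr0_norm.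
by rewrite ler_wsqrtr// lerDl.
Qed.

Lemma sqrt_shift_gt0 d a : 0 < d -> 0 <= a -> 0 < sqrt_shift d a.
Proof. by move=> d0 a0; apply: lt_le_trans (sqrt_shift_ge d a d0 a0). Qed.

Lemma sqr_sqrt_shift d a : 0 <= a -> sqrt_shift d a ^+ 2 = d ^+ 2 + a.
Proof. by move=> a0; rewrite sqr_sqrtr// addr_ge0// sqr_ge0. Qed.

(* With [a = |x|^2], [b = |y|^2] and [c = <x, y>] this is the second order
   Taylor estimate of the convex function [x |-> sqrt (d^2 + |x|^2)]. *)
Lemma sqrt_shift_taylor d a b c : 0 < d -> 0 <= a -> 0 <= b ->
  c ^+ 2 <= a * b ->
  0 <= sqrt_shift d b - sqrt_shift d a - (c - a) / sqrt_shift d a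
    <= (a - 2 * c + b) / (2 * d).
Proof.
move=> d0 a0 b0 cab.
have := sqr_sqrt_shift d a a0; have := sqr_sqrt_shift d b b0.
have := sqrt_shift_ge d a d0 a0; have := sqrt_shift_ge d b d0 b0.
set p := sqrt_shift d a; set q := sqrt_shift d b => dq dp q2 p2.
have p0 : 0 < p by lra.
(* The lower bound is now the Cauchy-Schwarz inequality for the vectors [(d, x)] and [(d, y)]; the
   upper bound follows from [2 p q <= p^2 + q^2] and [d <= p]. *)
have -> : q - p - (c - a) / p = (p * q - d ^+ 2 - c) / p.
  apply: (mulIf (lt0r_neq0 p0)); rewrite mulrBl !divfK ?lt0r_neq0// mulrBl.
  by rewrite -[p * p]/(p ^+ 2) p2; ring.
have c2 : 2 * c <= a + b.
  have : (2 * c) ^+ 2 <= (a + b) ^+ 2 by have := sqr_ge0 (a - b); nra.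
  by have [c0|c0] := leP c 0; [lra|rewrite ler_pXn2r ?nnegrE//; lra].
apply/andP; split.
  apply: divr_ge0; last exact: ltW.
  have [|cd0] := leP (d ^+ 2 + c) 0; first by nra.
  suff : d ^+ 2 + c <= p * q by lra.
  rewrite -(@ler_pXn2r _ 2)// ?nnegrE; [|lra|nra].
  rewrite exprMn p2 q2; have := sqr_ge0 d; nra.
rewrite ler_pdivrMr// mulrAC ler_pdivlMr; last lra.
have : p * q - d ^+ 2 - c <= (a - 2 * c + b) / 2.
  have := sqr_ge0 (p - q); nra.
have : 0 <= a - 2 * c + b by lra.
nra.
Qed.

Lemma sqrt_shift_le d a : 0 < d -> sqrt_shift d (a ^+ 2) <= d + `|a|.
Proof.
move=> d0; have -> : d + `|a| = Num.sqrt ((d + `|a|) ^+ 2).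
  by rewrite sqrtr_sqr [RHS]ger0_norm// addr_ge0// ltW.
rewrite ler_wsqrtr// sqrrD real_normK ?num_real// lerD2r lerDl.
by rewrite mulrn_wge0// mulr_ge0// ltW.
Qed.

Lemma ge_sqrt_shift d a : `|a| <= sqrt_shift d (a ^+ 2).
Proof. by rewrite -sqrtr_sqr ler_wsqrtr// lerDr sqr_ge0. Qed.

Lemma sqrt_shift_continuous d : continuous (sqrt_shift d).
Proof.
move=> a; apply: (@continuous_comp _ _ _ (fun b => d ^+ 2 + b) Num.sqrt).
  exact: (cvgD (cvg_cst _) cvg_id).
exact: sqrt_continuous.
Qed.

(** The formula [s_+ = (s + |s|) / 2] with [|s|] smoothed. *)
Definition softpos d s := (s + sqrt_shift d (s ^+ 2)) / 2.

Definition dsoftpos d s := (1 + s / sqrt_shift d (s ^+ 2)) / 2.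

(** Strict because [|s| < sqrt (d^2 + s^2)]. The strict lower bound is what makes the time penalty
    contribute a positive derivative. *)
Lemma dsoftpos_itv d s : 0 < d -> 0 < dsoftpos d s < 1.
Proof.
move=> d0; have q0 := sqrt_shift_gt0 d _ d0 (sqr_ge0 s).
have q2 := sqr_sqrt_shift d _ (sqr_ge0 s).
have : `|s / sqrt_shift d (s ^+ 2)| < 1.
  rewrite normrM normfV (gtr0_norm q0) ltr_pdivrMr// mul1r.
  rewrite -(@ltr_pXn2r _ 2)// ?nnegrE ?ltW// q2 real_normK ?num_real//.
  by rewrite ltrDr exprn_gt0.
by rewrite /dsoftpos ltr_norml; lra.
Qed.

Lemma softpos_taylor d s s' : 0 < d ->
  0 <= softpos d s' - softpos d s - dsoftpos d s * (s' - s)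
    <= (s' - s) ^+ 2 / (4 * d).
Proof.
move=> d0.
have h : (s * s') ^+ 2 <= s ^+ 2 * s' ^+ 2 by rewrite exprMn.
have := sqrt_shift_taylor d _ _ _ d0 (sqr_ge0 s) (sqr_ge0 s') h.
have q0 := sqrt_shift_gt0 d _ d0 (sqr_ge0 s).
rewrite /softpos /dsoftpos.
set q := sqrt_shift d (s ^+ 2) in q0 *; set q' := sqrt_shift d _.
have -> : (s * s' - s ^+ 2) / q = s / q * (s' - s) by ring.
have -> : (s ^+ 2 - 2 * (s * s') + s' ^+ 2) / (2 * d) =
    2 * ((s' - s) ^+ 2 / (4 * d)).
  by field; rewrite gt_eqF.
by lra.
Qed.

(** By convexity the graph lies above its tangent at the point of larger value, whose slope is
    between 0 and 1. *)
Lemma softpos_lip d s s' : 0 < d -> `|softpos d s - softpos d s'| <= `|s - s'|.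
Proof.
move=> d0; wlog ss' : s s' / softpos d s' <= softpos d s => [hw|].
  have [/hw//|/ltW/hw] := leP (softpos d s') (softpos d s).
  by rewrite distrC [X in _ -> _ <= X]distrC.
rewrite ger0_norm ?subr_ge0//.
have /andP[h _] := softpos_taylor d s s' d0.
have /andP[p0 p1] := dsoftpos_itv d s d0.
have := ler_norm (s - s'); have := normr_ge0 (s - s'); nra.
Qed.

Lemma softpos_bounds d s : 0 < d ->
  Num.max s 0 <= softpos d s <= Num.max s 0 + d / 2.
Proof.
move=> d0; have := sqrt_shift_le d s d0; have := ge_sqrt_shift d s.
rewrite /softpos; case: (leP s 0) => s0; last by rewrite gtr0_norm//; lra.
by rewrite ler0_norm//; lra.
Qed.

Lemma softpos_continuous d : continuous (softpos d).
Proof.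
move=> s; have sc : continuous (fun s : R => sqrt_shift d (s ^+ 2)).
  move=> t; apply: (@continuous_comp _ _ _ (fun b : R => b ^+ 2) (sqrt_shift d)).
    exact: exprn_continuous.
  exact: sqrt_shift_continuous.
exact: (cvgM (cvgD cvg_id (sc s)) (cvg_cst _)).
Qed.

Lemma dsoftpos_continuous d : 0 < d -> continuous (dsoftpos d).
Proof.
move=> d0 s; apply: cvgM; last exact: cvg_cst.
apply: cvgD; first exact: cvg_cst.
apply: cvgM; first exact: cvg_id.
apply: cvgV; first by rewrite gt_eqF// sqrt_shift_gt0// sqr_ge0.
apply: (@continuous_comp _ _ _ (fun b : R => b ^+ 2) (sqrt_shift d)).
  exact: exprn_continuous.
exact: sqrt_shift_continuous.
Qed.
End SmoothRoot.

Section SmoothNorm.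
Context {R : realType} {H : finHilbertType R}.
Implicit Types (d : R) (x y : H).

Definition softnorm d x : R := sqrt_shift d (`|x| ^+ 2).

Definition dsoftnorm d x : H := (softnorm d x)^-1 *: x.

Lemma softnorm_gt0 d x : 0 < d -> 0 < softnorm d x.
Proof. by move=> d0; rewrite sqrt_shift_gt0// sqr_ge0. Qed.

Lemma softnorm_bounds d x : 0 < d -> `|x| <= softnorm d x <= `|x| + d.
Proof.
move=> d0; have := sqrt_shift_le d `|x| d0; have := ge_sqrt_shift d `|x|.
by rewrite /softnorm normr_id (addrC d) => -> ->.
Qed.

Lemma dsoftnorm_le1 d x : 0 < d -> `|dsoftnorm d x| <= 1.
Proof.
move=> d0; have q0 := softnorm_gt0 d x d0.
rewrite normrZ normfV gtr0_norm// ler_pdivrMl// mulr1.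
by have /andP[] := softnorm_bounds d x d0.
Qed.

Lemma softnorm_taylor d x y : 0 < d ->
  0 <= softnorm d y - softnorm d x - dotp (dsoftnorm d x) (y - x)
    <= `|y - x| ^+ 2 / (2 * d).
Proof.
move=> d0.
have h : (dotp x y) ^+ 2 <= `|x| ^+ 2 * `|y| ^+ 2.
  rewrite -exprMn -[leLHS]real_normK ?num_real// ler_pXn2r ?nnegrE ?mulr_ge0//.
  exact: cauchy_schwarz.
have := sqrt_shift_taylor d _ _ _ d0 (sqr_ge0 `|x|) (sqr_ge0 `|y|) h.
rewrite -/(softnorm d x) -/(softnorm d y) normB_sqr (dotpC y x).
rewrite dotpZl dotpDr dotpNr dotpp.
have -> : (dotp x y - `|x| ^+ 2) / softnorm d x =
  (softnorm d x)^-1 * (dotp x y - `|x| ^+ 2) by rewrite mulrC.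
have -> : `|x| ^+ 2 - 2 * dotp x y + `|y| ^+ 2 =
    `|y| ^+ 2 - 2 * dotp x y + `|x| ^+ 2.
  by ring.
by [].
Qed.

Lemma softnorm_lip d x y : 0 < d -> `|softnorm d x - softnorm d y| <= `|x - y|.
Proof.
move=> d0; wlog xy : x y / softnorm d y <= softnorm d x => [hw|].
  have [/hw//|/ltW/hw] := leP (softnorm d y) (softnorm d x).
  by rewrite distrC [X in _ -> _ <= X]distrC.
rewrite ger0_norm ?subr_ge0//.
have /andP[h _] := softnorm_taylor d x y d0.
have := dotp_le (dsoftnorm d x) (x - y); rewrite -(opprB y x) dotpNr.
have := dsoftnorm_le1 d x d0; rewrite normrN.
have := normr_ge0 (y - x); nra.
Qed.

Lemma softnorm_continuous d : continuous (softnorm d).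
Proof.
move=> x; apply: (@continuous_comp _ _ _ (fun y : H => `|y| ^+ 2) (sqrt_shift d)).
  apply: (@continuous_comp _ _ _ (fun y : H => `|y|) (fun b : R => b ^+ 2)).
    exact: norm_continuous.
  exact: exprn_continuous.
exact: sqrt_shift_continuous.
Qed.

Lemma dsoftnorm_continuous d : 0 < d -> continuous (dsoftnorm d).
Proof.
move=> d0 x; apply: cvgZ; last exact: cvg_id.
apply: cvgV; first by rewrite gt_eqF// softnorm_gt0.
exact: softnorm_continuous.
Qed.
End SmoothNorm.

(** * Smooth test functions on a generating cone *)

Section ConvexCone.
Context {R : realType} {H : finHilbertType R}.

(** The sum is twice the midpoint. *)
Lemma cone_add (D : set H) (x y : H) :
  closed_convex_cone D -> D x -> D y -> D (x + y).
Proof.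
move=> [_ cD sD] Dx Dy.
have half_itv : 0 <= (2^-1 : R) <= 1 by rewrite invr_ge0 ler0n/= invf_le1// ler1n.
have [h0 h1] := andP half_itv.
have : D (2^-1 *: x + (1 - 2^-1) *: y).
  by have := cD x y (Itv01 h0 h1) (mem_set Dx) (mem_set Dy); rewrite inE.
have -> : 1 - 2^-1 = 2^-1 :> R by lra.
move=> /(sD 2 _ (ler0n _ _)).
by rewrite -scalerDr scalerA divff ?pnatr_eq0// scale1r.
Qed.

(** The kernel of [<x, .>] is closed and contains all differences of points of [D], hence it is the
    whole space and contains [x]. *)
Lemma generates_dotp_eq0 (D : set H) (x : H) : generates D ->
  (forall y, D y -> dotp x y = 0) -> x = 0.
Proof.
move=> genD xD; have dc : continuous (dotp x : H -> R).
  move=> y; apply/cvgrPdist_le => /= e e0.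
  have x1 : 0 < `|x| + 1 by rewrite ltr_pwDr.
  near=> z; have : `|y - z| <= (`|x| + 1)^-1 * e.
    by near: z; apply: cvgr_dist_le; rewrite ?mulr_gt0 ?invr_gt0.
  rewrite ler_pdivlMl// -dotpNr -dotpDr => /(le_trans _); apply.
  by rewrite (le_trans (cauchy_schwarz _ _))// ler_wpM2r// lerDl.
have : [set: H] `<=` [set y | dotp x y = 0].
  have cl : closed [set y | dotp x y = 0].
    apply: (@closed_comp _ _ (dotp x : H -> R) [set 0]) => [y _|]; first exact: dc.
    exact: closed_eq.
  rewrite -genD [X in _ `<=` X](iffLR (closure_id _) cl); apply: closureS.
  by move=> _ [y Dy [z Dz <-]] /=; rewrite dotpDr dotpNr !xD// subrr.
by move=> /(_ x I) /= /eqP; rewrite dotpp sqrf_eq0 normr_eq0 => /eqP.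
Unshelve. all: by end_near.
Qed.
End ConvexCone.

(** * Uniqueness of derivatives, and a stable class of test functions *)

Section Smoothness.
Context {R : realType} {H : finHilbertType R}.
Implicit Types (D : set H) (phi g : R * H -> R) (dphi dg : R * H -> R * H).

(* Two expansions can differ only in directions that leave the domain. *)
Lemma expansion_dir D phi z d d' (e : R * H) :
  expansion D phi z d -> expansion D phi z d' ->
  (forall s, 0 < s -> pos_time D (z + s *: e)) ->
  (d.1 - d'.1) * e.1 + dotp (d.2 - d'.2) e.2 = 0.
Proof.
move=> /eqoP hd /eqoP hd' he.
set l := (X in X = 0); set N := `|e.1| + `|e.2|.
have N0 : 0 <= N by rewrite addr_ge0.
(* At [z + s e] with [s] small, both Taylor errors are at most [eps s N] in absolute value, and they
   differ by [s l]. *)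
suff : forall eps, 0 < eps -> `|l| <= eps * (2 * N).
  move=> h; apply/eqP; rewrite -normr_eq0 eq_le normr_ge0 andbT.
  apply/ler_addgt0Pr => eps eps0; rewrite add0r.
  have N1 : 0 < 2 * N + 1 by lra.
  have := h (eps / (2 * N + 1)) (divr_gt0 eps0 N1).
  move=> /le_trans; apply; rewrite mulrAC ler_pdivrMr//.
  by have := mulr_ge0 (ltW eps0) N0; clear - eps0; lra.
move=> eps eps0.
have hn : within (pos_time D) (nbhs z)
    [set w | `|taylor_error phi z d w| <= eps * `| `|w.1 - z.1| + `|w.2 - z.2| | /\
             `|taylor_error phi z d' w| <= eps * `| `|w.1 - z.1| + `|w.2 - z.2| |].
  exact: filterI (hd _ eps0) (hd' _ eps0).
move: hn; rewrite /within /= => /nbhs_ballP[del /= del0 hdel].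
have [s s0 sN] : exists2 s, 0 < s & s * N < del.
  exists (del / 2 / (1 + N)); first by rewrite !divr_gt0// ltr_pwDl.
  rewrite mulrAC ltr_pdivrMr ?ltr_pwDl//.
  by have := mulr_ge0 (ltW del0) N0; clear - del0; lra.
have se1 : `|s * e.1| < del.
  rewrite normrM gtr0_norm// (le_lt_trans _ sN)// ler_pM2l// /N lerDl//.
have se2 : `|s *: e.2| < del.
  rewrite normrZ gtr0_norm// (le_lt_trans _ sN)// ler_pM2l// /N lerDr//.
have [] := hdel (z + s *: e) _ (he _ s0).
  split; rewrite /= -ball_normE /ball_ /= opprD addrA subrr add0r normrN//.
have E1 : (z + s *: e).1 - z.1 = s * e.1 by rewrite /= addrAC subrr add0r.
have E2 : (z + s *: e).2 - z.2 = s *: e.2 by rewrite /= addrAC subrr add0r.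
rewrite /taylor_error E1 E2.
have -> : `| `|s * e.1| + `|s *: e.2| | = s * N.
  by rewrite [LHS]ger0_norm ?addr_ge0// normrM normrZ (gtr0_norm s0) -mulrDr.
rewrite !dotpZr.
set P := phi _ - phi _ => h1 h2.
have : s * `|l| <= s * (eps * (2 * N)).
  rewrite -{1}(gtr0_norm s0) -normrM /l dotpDl dotpNl.
  by move: h1 h2; rewrite !ler_norml; lra.
by rewrite ler_pM2l.
Qed.

(** The directions [(1, 0)] and [(0, y)] with [y] in [D] never leave the domain, even from a
    boundary point. The first determines the time derivative; the others determine the gradient
    since [D] generates [H]. *)
Lemma expansion_unique D phi z d d' :
  closed_convex_cone D -> generates D -> pos_time D z ->
  expansion D phi z d -> expansion D phi z d' -> d = d'.
Proof.
move=> D_cone D_gen [z10 Dz] hd hd'.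
have e1 : d.1 = d'.1.
  have := expansion_dir D phi z d d' (1, 0) hd hd'.
  rewrite /= mulr1 dotp0r addr0 => h.
  apply/subr0_eq/h => s s0; split => /=; first by rewrite [s *: 1]mulr1 addr_gt0.
  by rewrite scaler0 addr0.
have e2 : d.2 - d'.2 = 0.
  apply: (generates_dotp_eq0 D) => // y Dy.
  have := expansion_dir D phi z d d' (0, y) hd hd'.
  rewrite /= mulr0 add0r; apply => s s0; split => /=; first by rewrite scaler0 addr0.
  by apply: cone_add => //; case: D_cone => _ _; apply => //; exact: ltW.
case: d d' hd hd' e1 e2 => d1 d2 [d1' d2'] /= _ _ -> /eqP.
by rewrite subr_eq0 => /eqP ->.
Qed.

(* A sufficient condition for smoothness, with a uniform quadratic error on the
   whole space, which is stable under sums. *)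
Definition uniformly_C11 phi dphi : Prop :=
  continuous dphi /\ exists K : R, forall z w,
    `|taylor_error phi z (dphi z) w| <=
      K * (`|w.1 - z.1| ^+ 2 + `|w.2 - z.2| ^+ 2).

Lemma uniformly_C11_smooth D phi dphi :
  closed_convex_cone D -> generates D -> uniformly_C11 phi dphi ->
  smooth D phi dphi.
Proof.
move=> D_cone D_gen [dphi_cont [K0 hK0]].
have [K K_gt0 hK] : exists2 K, 0 < K & forall z w,
    `|taylor_error phi z (dphi z) w| <=
      K * (`|w.1 - z.1| ^+ 2 + `|w.2 - z.2| ^+ 2).
  exists (`|K0| + 1) => [|z w]; first by rewrite ltr_pwDr.
  rewrite (le_trans (hK0 _ _))// ler_wpM2r ?addr_ge0 ?sqr_ge0//.
  by rewrite (le_trans (ler_norm _))// lerDl.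
have expn z : expansion D phi z (dphi z).
  apply/eqoP => eps eps0; apply: cvg_within.
  have e0 : 0 < eps / K by rewrite divr_gt0.
  (* If [a] and [b] are below [eps / K], then [K (a^2 + b^2) <= eps (a + b)]. *)
  apply/nbhs_ballP; exists (eps / K) => //= w [].
  rewrite -!ball_normE /ball_ /= (distrC z.1) (distrC z.2) => w1 w2.
  rewrite (le_trans (hK z w))// [X in eps * X]ger0_norm ?addr_ge0//.
  move: w1 w2; rewrite !ltr_pdivlMr//.
  have := normr_ge0 (w.1 - z.1); have := normr_ge0 (w.2 - z.2).
  move: `|w.1 - z.1| `|w.2 - z.2| => a b b0 a0 ha hb.
  by have := ler_wpM2r a0 (ltW ha); have := ler_wpM2r b0 (ltW hb); lra.
split.
- move=> z Dz; split; first exact: expn.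
  by move=> d' hd'; apply: (expansion_unique D phi z).
- move=> z Dz; apply/eqO_exP; exists K => //; apply: nearW => w.
  exact: le_trans (hK z w) (ler_wpM2l (ltW K_gt0) (ler_norm _)).
- exact: continuous_subspaceT.
Qed.

Lemma uniformly_C11D phi psi dphi dpsi :
  uniformly_C11 phi dphi -> uniformly_C11 psi dpsi ->
  uniformly_C11 (fun w => phi w + psi w) (fun w => dphi w + dpsi w).
Proof.
move=> [c1 [K1 h1]] [c2 [K2 h2]]; split.
  by move=> z; apply: cvgD; [exact: c1|exact: c2].
exists (K1 + K2) => z w; rewrite mulrDl.
have -> : taylor_error (fun w => phi w + psi w) z (dphi z + dpsi z) w =
    taylor_error phi z (dphi z) w + taylor_error psi z (dpsi z) w.
  by rewrite /taylor_error /= dotpDl; ring.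
by rewrite (le_trans (ler_normD _ _))// lerD.
Qed.

Lemma uniformly_C11Z c phi dphi : uniformly_C11 phi dphi ->
  uniformly_C11 (fun w => c * phi w) (fun w => c *: dphi w).
Proof.
move=> [c1 [K1 h1]]; split.
  by move=> z; apply: cvgZ; [exact: cvg_cst|exact: c1].
exists (`|c| * K1) => z w.
have -> : taylor_error (fun w => c * phi w) z (c *: dphi z) w =
    c * taylor_error phi z (dphi z) w.
  by rewrite /taylor_error /= dotpZl -[c *: (dphi z).1]/(c * _); ring.
by rewrite normrM -mulrA ler_wpM2l.
Qed.

(** The function is quadratic, so its Taylor error is exactly half the squared distance from [z] to
    [w]. *)
Lemma uniformly_C11_sqr_dist (z0 : R * H) :
  uniformly_C11 (fun w => ((w.1 - z0.1) ^+ 2 + `|w.2 - z0.2| ^+ 2) / 2)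
    (fun w => w - z0).
Proof.
split; first by move=> z; apply: cvgB; [exact: cvg_id|exact: cvg_cst].
exists 1 => z w; rewrite mul1r.
set e := taylor_error _ _ _ _.
have -> : e = ((w.1 - z.1) ^+ 2 + `|w.2 - z.2| ^+ 2) / 2.
  rewrite /e /taylor_error /= !normB_sqr !(dotpDl, dotpDr, dotpNl, dotpNr) dotpp.
  by rewrite (dotpC z.2 w.2) (dotpC z0.2 w.2) (dotpC z0.2 z.2); field.
rewrite ger0_norm ?divr_ge0 ?addr_ge0 ?sqr_ge0//.
rewrite real_normK ?num_real//.
by have := sqr_ge0 (w.1 - z.1); have := sqr_ge0 `|w.2 - z.2|; lra.
Qed.

(** Chain rule: the error is the remainder of [softpos] at [g z], quadratic in [g w - g z] and so
    controlled by the Lipschitz bound on [g], plus the error of [g] times a slope below 1. *)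
Lemma uniformly_C11_softpos (d K : R) g dg : 0 < d -> continuous g ->
  (forall z w, `|g w - g z| <= K * (`|w.1 - z.1| + `|w.2 - z.2|)) ->
  uniformly_C11 g dg ->
  uniformly_C11 (fun w => softpos d (g w)) (fun w => dsoftpos d (g w) *: dg w).
Proof.
move=> d0 cg gK [c1 [K1 h1]]; split.
  move=> z; apply: cvgZ; last exact: c1.
  exact: (@continuous_comp _ _ _ g (dsoftpos d) z (cg z) (dsoftpos_continuous d d0 _)).
exists (K ^+ 2 / (2 * d) + K1) => z w.
have -> : taylor_error (fun w => softpos d (g w)) z (dsoftpos d (g z) *: dg z) w =
    (softpos d (g w) - softpos d (g z) - dsoftpos d (g z) * (g w - g z)) +
    dsoftpos d (g z) * taylor_error g z (dg z) w.
  by rewrite /taylor_error /= dotpZl -[_ *: (dg z).1]/(_ * _); ring.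
rewrite mulrDl (le_trans (ler_normD _ _))// lerD//; last first.
  rewrite normrM (le_trans _ (h1 z w))// ler_piMl//.
  by have /andP[p0 p1] := dsoftpos_itv d (g z) d0; rewrite gtr0_norm// ltW.
have /andP[e0 e1] := softpos_taylor d (g z) (g w) d0.
rewrite ger0_norm// (le_trans e1)//.
have gK2 : (g w - g z) ^+ 2 <= K ^+ 2 * (2 * (`|w.1 - z.1| ^+ 2 + `|w.2 - z.2| ^+ 2)).
  rewrite -[leLHS]real_normK ?num_real//.
  rewrite (@le_trans _ _ ((K * (`|w.1 - z.1| + `|w.2 - z.2|)) ^+ 2))//.
    by rewrite ler_pXn2r ?nnegrE// (le_trans _ (gK z w)).
  rewrite exprMn ler_wpM2l ?sqr_ge0//.
  by have := sqr_ge0 (`|w.1 - z.1| - `|w.2 - z.2|); lra.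
rewrite ler_pdivrMr ?mulr_gt0// (le_trans gK2)// le_eqVlt; apply/orP; left.
by apply/eqP; field; rewrite gt_eqF.
Qed.

Lemma uniformly_C11_time (t0 : R) :
  uniformly_C11 (fun w => w.1 - t0) (fun=> (1, 0)).
Proof.
split; first by move=> z; exact: cvg_cst.
exists 0 => z w; rewrite mul0r /taylor_error /= dotp0l.
by rewrite (_ : _ - _ = 0) ?normr0//; ring.
Qed.

Lemma uniformly_C11_softcone (d V r : R) : 0 < d ->
  uniformly_C11 (fun w => softnorm d w.2 + V * w.1 - r)
    (fun w => (V, dsoftnorm d w.2)).
Proof.
move=> d0; split.
  move=> z; have c2 : continuous (fun w : R * H => dsoftnorm d w.2).
    move=> w; apply: (@continuous_comp _ _ _ snd (dsoftnorm d)).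
      exact: cvg_snd.
    exact: dsoftnorm_continuous.
  exact: (cvg_pair (cvg_cst V) (c2 z)).
exists (2 * d)^-1 => z w.
rewrite /taylor_error /=.
have -> : softnorm d w.2 + V * w.1 - r - (softnorm d z.2 + V * z.1 - r) -
    (V * (w.1 - z.1) + dotp (dsoftnorm d z.2) (w.2 - z.2)) =
    softnorm d w.2 - softnorm d z.2 - dotp (dsoftnorm d z.2) (w.2 - z.2) by ring.
have /andP[e0 e1] := softnorm_taylor d z.2 w.2 d0.
rewrite ger0_norm// (le_trans e1)// [leRHS]mulrC ler_pM2r ?invr_gt0 ?mulr_gt0//.
by rewrite lerDr sqr_ge0.
Qed.
End Smoothness.

(** * Doubling of variables *)

(** The points of [K] outside [U] with [c <= f] form a compact set on which [p] is positive, hence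
    bounded below; a large [a] pushes [f - a p] below [c] there. With [p] the squared distance of
    the two variables, one finite [a] suffices and no limit is taken. *)
Lemma compact_penalization (R : realType) (X : topologicalType) (K U : set X)
    (f p : X -> R) (c : R) :
  compact K -> {within K, continuous f} -> {within K, continuous p} ->
  open U -> (forall x, K x -> 0 <= p x) ->
  (forall x, K x -> p x = 0 -> c <= f x -> U x) ->
  exists2 a, 0 < a & forall x, K x -> c <= f x - a * p x -> U x.
Proof.
move=> K_compact f_cont p_cont U_open p_ge0 hU.
have [W W_closed WK] : exists2 W, closed W &
    W `&` K = f @^-1` [set y | c <= y] `&` K.
  apply/closed_subspaceP; apply: closed_comp; last exact: closed_ge.
  by move=> x _; exact: f_cont.
have WP x : K x -> W x <-> c <= f x.
  move=> Kx; split => [Wx|fx].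
    by have [] : (f @^-1` [set y | c <= y] `&` K) x by rewrite -WK.
  by have [] : (W `&` K) x by rewrite WK.
pose K' := K `&` (W `&` ~` U).
have K'_compact : compact K'.
  apply: compact_closedI => //; apply: closedI => //; exact: open_closedC.
have K'K : K' `<=` K by move=> x [].
have [K'0|/set0P K'0] := eqVneq K' set0.
  exists 1 => // x Kx; rewrite mul1r => fpx; apply: contrapT => Ux.
  suff : K' x by rewrite K'0.
  split => //; split => //; apply/WP => //.
  by have := p_ge0 x Kx; lra.
have [y yK' hy] := compact_EVT_min K'0 K'_compact
  (continuous_subspaceW K'K p_cont).
have [z zK' hz] := compact_EVT_max K'0 K'_compact
  (continuous_subspaceW K'K f_cont).
move: yK' zK'; rewrite !inE => yK' zK'.
have fz : c <= f z by case: zK' => Kz [Wz _]; exact/WP.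
have py : 0 < p y.
  case: yK' => Ky [/(WP _ Ky) fy Uy]; rewrite lt_neqAle p_ge0// andbT.
  by apply/eqP => py; apply/Uy/hU.
(* The quotient of the largest excess of [f] over [c] by the least value of [p] brings the function
   down to [c]; the added 1 makes the inequality strict. *)
exists ((f z - c) / p y + 1) => [|x Kx].
  by rewrite ltr_wpDl// divr_ge0 ?subr_ge0// ltW.
move=> fpx; apply: contrapT => Ux.
have a0 : 0 <= (f z - c) / p y by rewrite divr_ge0 ?subr_ge0// ltW.
have K'x : K' x.
  split => //; split => //; apply/WP => //.
  by have := mulr_ge0 a0 (p_ge0 x Kx); have := p_ge0 x Kx; lra.
have := hy x (mem_set K'x); have := hz x (mem_set K'x) => fx px.
have := ler_wpM2l a0 px; rewrite divfK ?gt_eqF//; lra.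
Qed.

Lemma within_continuous_fst {X Y Z : topologicalType} (A : set X) (B : set Y)
    (f : X -> Z) :
  {within A, continuous f} -> {within A `*` B, continuous (fun w => f w.1)}.
Proof.
move=> /subspace_continuousP hf; apply/subspace_continuousP => -[x y] [/= Ax By] W hW.
have hx : nbhs (x, y) (fst @^-1` [set x' | A x' -> W (f x')]).
  exact: (@cvg_fst _ _ (nbhs x) (nbhs y) _ _ (hf x Ax W hW)).
by apply: (@filterS _ (nbhs (x, y)) _ _ _ _ hx) => -[x' y'] /= h [Ax' _]; exact: h.
Qed.

Lemma within_continuous_snd {X Y Z : topologicalType} (A : set X) (B : set Y)
    (f : Y -> Z) :
  {within B, continuous f} -> {within A `*` B, continuous (fun w => f w.2)}.
Proof.
move=> /subspace_continuousP hf; apply/subspace_continuousP => -[x y] [/= Ax By] W hW.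
have hy : nbhs (x, y) (snd @^-1` [set y' | B y' -> W (f y')]).
  exact: (@cvg_snd _ _ (nbhs x) (nbhs y) _ _ (hf y By W hW)).
by apply: (@filterS _ (nbhs (x, y)) _ _ _ _ hy) => -[x' y'] /= h [_ By']; exact: h.
Qed.

(** * Pointwise bounds from the best Lipschitz constant *)

Section LipschitzNorm.
Context {R : realType} {H : finHilbertType R}.

Lemma lip_norm_ge0 (D : set H) (f : H -> R) : (0 <= lip_norm D f)%E.
Proof. by apply: le_ereal_inf_tmp => _ [k [k0 _] <-]; rewrite lee_fin. Qed.

Lemma lip_normP (D : set H) (f : H -> R) (L : R) (x y : H) :
  (lip_norm D f <= L%:E)%E -> D x -> D y -> `|f x - f y| <= L * `|x - y|.
Proof.
move=> fL Dx Dy; apply/ler_addgt0Pr => e e0.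
have n0 : 0 < `|x - y| + 1 by rewrite ltr_pwDr.
(* A constant near the infimum is enough: the slack, multiplied by [|x - y|], stays below [e]. *)
have : (lip_norm D f < (L + e / (`|x - y| + 1))%:E)%E.
  by rewrite (le_lt_trans fL)// lte_fin ltrDl divr_gt0.
move=> /ereal_inf_lt[_ [k [k0 hk] <-]]; rewrite lte_fin => /ltW kL.
have := hk (x, y) (conj Dx Dy) => /= /le_trans; apply.
rewrite (le_trans (ler_wpM2r (normr_ge0 _) kL))// mulrDl lerD2l.
by rewrite mulrAC ler_pdivrMr// ler_wpM2l ?ltW// ltrDl.
Qed.

Lemma lip_supP (C C' : set H) (u v : R * H -> R) (L : R) :
  L%:E = lip_sup C C' u v ->
  [/\ 0 <= L,
      forall t x y, 0 <= t -> C x -> C y ->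
        `|u (t, x) - u (t, y)| <= L * `|x - y| &
      forall t x y, 0 <= t -> C' x -> C' y ->
        `|v (t, x) - v (t, y)| <= L * `|x - y|].
Proof.
move=> LE.
have hL t : 0 <= t ->
    (maxe (lip_norm C (fun x => u (t, x)))
          (lip_norm C' (fun x => v (t, x))) <= L%:E)%E.
  by move=> t0; rewrite LE; apply: ereal_sup_ubound; exists t.
split.
- rewrite -lee_fin (le_trans _ (hL 0 (lexx _)))// le_max.
  by rewrite lip_norm_ge0.
- move=> t x y t0; apply: (lip_normP C (fun x => u (t, x))).
  by rewrite (le_trans _ (hL t t0))// le_max lexx.
- move=> t x y t0; apply: (lip_normP C' (fun x => v (t, x))).
  by rewrite (le_trans _ (hL t t0))// le_max lexx orbT.
Qed.
End LipschitzNorm.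

Lemma open_setX {X Y : topologicalType} (A : set X) (B : set Y) :
  open A -> open B -> open (A `*` B).
Proof.
move=> A_open B_open; rewrite openE => -[x y] [/= Ax By].
by exists (A, B) => //; split; exact: open_nbhs_nbhs.
Qed.

Section Comparison.
Context {R : realType} {H : finHilbertType R}.

(** Halved so that the derivative in [z] is [z - w]. *)
Definition sqr_dist (z w : R * H) : R :=
  ((z.1 - w.1) ^+ 2 + `|z.2 - w.2| ^+ 2) / 2.

Lemma sqr_distC z w : sqr_dist z w = sqr_dist w z.
Proof. by rewrite /sqr_dist (distrC z.2) -(opprB w.1) sqrrN. Qed.

Lemma sqr_dist_ge0 z w : 0 <= sqr_dist z w.
Proof. by rewrite divr_ge0// addr_ge0// sqr_ge0. Qed.

Lemma sqr_dist_eq0 z w : sqr_dist z w = 0 -> z = w.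
Proof.
move=> h; have := sqr_ge0 (z.1 - w.1); have := sqr_ge0 `|z.2 - w.2|.
move: h; rewrite /sqr_dist => h h1 h2.
have /eqP : (z.1 - w.1) ^+ 2 = 0 by lra.
have /eqP : `|z.2 - w.2| ^+ 2 = 0 by lra.
rewrite !sqrf_eq0 normr_eq0 !subr_eq0 => /eqP e2 /eqP e1.
by case: z w e1 e2 {h h1 h2} => z1 z2 [w1 w2] /= -> ->.
Qed.

(* A smooth approximation of [(|x| + V t - r)_+]. *)
Definition barrier (d V r : R) (w : R * H) : R :=
  softpos d (softnorm d w.2 + V * w.1 - r).

Lemma softcone_continuous d V r :
  continuous (fun w : R * H => softnorm d w.2 + V * w.1 - r).
Proof.
move=> w; have norm_cont : continuous (fun w : R * H => softnorm d w.2).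
  move=> w'; apply: (@continuous_comp _ _ _ snd (softnorm d)).
    exact: cvg_snd.
  exact: softnorm_continuous.
exact: (cvgB (cvgD (norm_cont w) (cvgM (cvg_cst V) cvg_fst)) (cvg_cst r)).
Qed.

Lemma barrier_continuous d V r : continuous (barrier d V r).
Proof.
move=> w; apply: (@continuous_comp _ _ _
  (fun w : R * H => softnorm d w.2 + V * w.1 - r) (softpos d)).
  exact: softcone_continuous.
exact: softpos_continuous.
Qed.

Lemma barrier_lip d V r t x y : 0 < d ->
  `|barrier d V r (t, x) - barrier d V r (t, y)| <= `|x - y|.
Proof.
move=> d0; rewrite (le_trans (softpos_lip _ _ _ d0))//=.
rewrite [X in `|X|](_ : _ = softnorm d x - softnorm d y) ?softnorm_lip//.
by ring.
Qed.

(** The error [3 d / 2] is [d] from smoothing the norm plus [d / 2] from smoothing the positive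
    part. *)
Lemma barrier_bounds d V r w : 0 < d ->
  Num.max (`|w.2| + V * w.1 - r) 0 <= barrier d V r w
    <= Num.max (`|w.2| + V * w.1 - r) 0 + 3 * (d / 2).
Proof.
move=> d0; have /andP[n1 n2] := softnorm_bounds d w.2 d0.
have /andP[] := softpos_bounds d (softnorm d w.2 + V * w.1 - r) d0.
rewrite -/(barrier d V r w) !maxEle.
by case: ifPn; case: ifPn; rewrite -?ltNge; lra.
Qed.

Lemma uniformly_C11_barrier d V r : 0 < d -> 0 <= V ->
  uniformly_C11 (barrier d V r) (fun w =>
    dsoftpos d (softnorm d w.2 + V * w.1 - r) *: (V, dsoftnorm d w.2)).
Proof.
move=> d0 V0; have cone_C11 := @uniformly_C11_softcone R H d V r d0.
have cone_lip (z w : R * H) :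
    `|softnorm d w.2 + V * w.1 - r - (softnorm d z.2 + V * z.1 - r)| <=
    (1 + V) * (`|w.1 - z.1| + `|w.2 - z.2|).
  have -> : softnorm d w.2 + V * w.1 - r - (softnorm d z.2 + V * z.1 - r) =
    (softnorm d w.2 - softnorm d z.2) + V * (w.1 - z.1) by ring.
  rewrite (le_trans (ler_normD _ _))// normrM (ger0_norm V0).
  have := softnorm_lip d w.2 z.2 d0.
  have := normr_ge0 (w.1 - z.1); have := normr_ge0 (w.2 - z.2); nra.
exact: uniformly_C11_softpos d0 (softcone_continuous d V r) cone_lip cone_C11.
Qed.

(** Write [p] for the doubling gradient, [q] for the barrier gradient, and [th], [tau] for the
    slopes of the barrier and of the time penalty. Subtracting the two viscosity inequalities
    cancels the doubling time derivatives and leaves [M th V + B tau <= h (p + q) - h p]. The right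
    side is at most [V |q| <= V M th], which contradicts [B tau > 0]. *)
Lemma no_interior_max (C C' : set H) (h : H -> R) (u v : R * H -> R)
    (L M a d B r t0 : R) (z z' : R * H) :
  closed_convex_cone C -> closed_convex_cone C' ->
  generates C -> generates C' -> locally_lipschitz h ->
  viscosity_subsolution C h u -> viscosity_supersolution C' h v ->
  0 < M -> 0 < d -> 0 < B ->
  pos_time C z -> pos_time C' z' ->
  local_max_on (pos_time C) (fun w => u w - (a * sqr_dist w z' +
    (M * barrier d (ball_lip h (2 * L + 3 * M)) r w +
     B * softpos d (w.1 - t0)))) z ->
  local_min_on (pos_time C') (fun w => v w - (- a) * sqr_dist w z) z' ->
  `|a *: (z.2 - z'.2)| <= 2 * L + 2 * M ->
  False.
Proof.
set V := ball_lip h _.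
move=> C_cone C'_cone C_gen C'_gen h_lip [_ u_sub] [_ v_super] M0 d0 B0 Cz C'z'.
move=> u_max v_min p_le; have V0 : 0 <= V := ball_lip_ge0 _ _.
have time_C11 : uniformly_C11 (fun w : R * H => softpos d (w.1 - t0))
    (fun w => dsoftpos d (w.1 - t0) *: (1, 0)).
  apply: (uniformly_C11_softpos d 1) => //.
  - by move=> w; apply: cvgB; [exact: cvg_fst|exact: cvg_cst].
  - move=> w w'; rewrite mul1r opprB addrA subrK lerDl//.
  - exact: uniformly_C11_time.
have phi_C11 := uniformly_C11D _ _ _ _
  (uniformly_C11Z a _ _ (uniformly_C11_sqr_dist z'))
  (uniformly_C11D _ _ _ _
    (uniformly_C11Z M _ _ (uniformly_C11_barrier d V r d0 V0))
    (uniformly_C11Z B _ _ time_C11)).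
have psi_C11 := uniformly_C11Z (- a) _ _ (uniformly_C11_sqr_dist z).
have uI := u_sub _ _ z Cz
  (uniformly_C11_smooth C _ _ C_cone C_gen phi_C11) u_max.
have vI := v_super _ _ z' C'z'
  (uniformly_C11_smooth C' _ _ C'_cone C'_gen psi_C11) v_min.
set th := dsoftpos d (softnorm d z.2 + V * z.1 - r).
set tau := dsoftpos d (z.1 - t0).
set p := a *: (z.2 - z'.2) in p_le *; pose q := (M * th) *: dsoftnorm d z.2.
have {}uI : a * (z.1 - z'.1) + (M * (th * V) + B * (tau * 1)) - h (p + q) <= 0.
  by move: uI; rewrite /= !scaler0 addr0 (scalerA M _ (dsoftnorm d z.2)).
have {}vI : 0 <= - a * (z'.1 - z.1) - h p.
  have pE : - a *: (z'.2 - z.2) = p by rewrite /p scaleNr -scalerN opprB.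
  by move: vI; rewrite /= pE.
have /andP[th0 th1] := dsoftpos_itv d (softnorm d z.2 + V * z.1 - r) d0.
rewrite -/th in th0 th1.
have /andP[tau0 _] := dsoftpos_itv d (z.1 - t0) d0.
rewrite -/tau in tau0.
have q_le : `|q| <= M * th.
  have Mth := mulr_gt0 M0 th0.
  by rewrite normrZ (gtr0_norm Mth) ler_piMr ?dsoftnorm_le1// ltW.
have q_leM : `|q| <= M by rewrite (le_trans q_le)// ler_piMr ?ltW.
(* Both points lie in the ball, as [|p| <= 2 L + 2 M] and [|q| <= M]. *)
have := ball_lipP h (2 * L + 3 * M) (p + q) p h_lip.
rewrite addrAC subrr add0r -/V => hV.
have {}hV : `|h (p + q) - h p| <= V * (M * th).
  apply: (le_trans (hV _ _)); last exact: ler_wpM2l.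
    by rewrite (le_trans (ler_normD _ _))//; lra.
  by lra.
move: hV; rewrite ler_norml => /andP[_ hV].
by have := mulr_gt0 B0 tau0; lra.
Qed.
(** An empty cone would have no differences, and the closure of the empty set is empty; so [D] has a
    point, which is scaled by 0. *)
Lemma generating_cone0 (D : set H) : closed_convex_cone D -> generates D -> D 0.
Proof.
move=> [_ _ sD] genD; have [x Dx] : D !=set0.
  have : closure [set x - y | x in D & y in D] (0 : H) by rewrite genD.
  by move=> /(_ setT filterT)[_ [[x Dx _] _]]; exists x.
by rewrite -(scale0r x); apply: sD.
Qed.

Lemma compact_cylinder (D : set H) (T rho : R) : closed D ->
  compact (`[0, T]%classic `*` (D `&` [set x | `|x| <= rho])).
Proof.
move=> D_closed; apply: compact_setX; first exact: segment_compact.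
rewrite setIC; apply: compact_closedI => //; exact: compact_closed_ball.
Qed.

Lemma cylinder_nonneg_time (D E : set H) (T rho : R) : D `<=` E ->
  `[0, T]%classic `*` (D `&` [set x | `|x| <= rho]) `<=` nonneg_time E.
Proof.
by move=> DE [t x] [/= /itvP t_itv [Dx _]]; split => /=; [rewrite t_itv|exact: DE].
Qed.

Lemma sqr_dist_continuous :
  continuous (fun w : (R * H) * (R * H) => sqr_dist w.1 w.2).
Proof.
have sqc : continuous (fun t : R => t ^+ 2) by exact: exprn_continuous.
have c1 : continuous (fun w : (R * H) * (R * H) => (w.1.1 - w.2.1) ^+ 2).
  move=> w; apply: (@continuous_comp _ _ _
    (fun w : (R * H) * (R * H) => w.1.1 - w.2.1)) (sqc _).
  exact: (cvgB (cvg_comp _ _ cvg_fst cvg_fst) (cvg_comp _ _ cvg_snd cvg_fst)).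
have c2 : continuous (fun w : (R * H) * (R * H) => `|w.1.2 - w.2.2| ^+ 2).
  move=> w; apply: (@continuous_comp _ _ _
    (fun w : (R * H) * (R * H) => `|w.1.2 - w.2.2|)) (sqc _).
  apply: cvg_norm.
  exact: (cvgB (cvg_comp _ _ cvg_fst cvg_snd) (cvg_comp _ _ cvg_snd cvg_snd)).
by move=> w; exact: (cvgM (cvgD (c1 w) (c2 w)) (cvg_cst _)).
Qed.

(** The bound [A] at the origin, with the Lipschitz bounds in space, limits the growth of [u - v] to
    slope [2 L] up to time [t0 + 1], below the slope [M] of the barrier. *)
Lemma comparison (C C' : set H) (h : H -> R) (u v : R * H -> R)
    (L M r m A t0 : R) (x0 : H) :
  closed_convex_cone C -> closed_convex_cone C' ->
  generates C -> generates C' -> C `<=` C' \/ C' `<=` C ->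
  locally_lipschitz h ->
  viscosity_subsolution C h u -> viscosity_supersolution C' h v ->
  0 <= L ->
  (forall t x y, 0 <= t -> C x -> C y ->
    `|u (t, x) - u (t, y)| <= L * `|x - y|) ->
  (forall t x y, 0 <= t -> C' x -> C' y ->
    `|v (t, x) - v (t, y)| <= L * `|x - y|) ->
  2 * L < M ->
  let V := ball_lip h (2 * L + 3 * M) in
  let F z := u z - v z - M * Num.max (`|z.2| + V * z.1 - r) 0 in
  (forall x, (C `&` C') x -> F (0, x) <= m) ->
  (forall t, 0 <= t <= t0 + 1 -> u (t, 0) - v (t, 0) <= A) ->
  0 <= t0 -> (C `&` C') x0 -> F (t0, x0) <= m.
Proof.
move=> C_cone C'_cone C_gen C'_gen CC' h_lip u_sub v_super L0 u_lip v_lip LM V F.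
move=> F0 uvA t00 Cx0; rewrite leNgt; apply/negP => mF.
have M0 : 0 < M by lra.
have V0 : 0 <= V := ball_lip_ge0 _ _.
have C0 := generating_cone0 C C_cone C_gen.
have C'0 := generating_cone0 C' C'_cone C'_gen.
have [C_closed C'_closed] : closed C /\ closed C' by case: C_cone; case: C'_cone.
pose T := t0 + 1.
(* [B] is chosen so that the function is at most [m] at time [T], [rho] so that
   it is at most [m] on the sphere of radius [rho], and [d] so that smoothing
   costs at most half of the gap [F (t0, x0) - m]. *)
pose B := `|A + M * r - m| + 1.
have B0 : 0 < B by rewrite ltr_pwDr.
pose rho := `|x0| + `|A + M * r - m| / (M - 2 * L) + 1.
have rho_x0 : `|x0| < rho.
  by rewrite /rho -addrA ltrDl ltr_wpDl// divr_ge0// subr_ge0 ltW.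
have rho_ge : A + M * r - m <= (M - 2 * L) * rho.
  have q1 := ler_norm (A + M * r - m).
  have := normr_ge0 x0; have ML : 0 < M - 2 * L by lra.
  have -> : (M - 2 * L) * rho = (M - 2 * L) * (`|x0| + 1) + `|A + M * r - m|.
    by rewrite /rho; field; rewrite gt_eqF.
  by move=> x00; have := mulr_gt0 ML (ltr_wpDl x00 ltr01); lra.
(* The midpoint of the gap, a level strictly above [m] that survives smoothing. *)
pose g := (F (t0, x0) + m) / 2.
pose d := (F (t0, x0) - m) / (3 * M + B).
have MB0 : 0 < 3 * M + B by lra.
have d0 : 0 < d by rewrite divr_gt0 ?subr_gt0.
have dE : (3 * M + B) * (d / 2) = (F (t0, x0) - m) / 2.
  by rewrite /d; field; rewrite gt_eqF.
have growth t x : 0 <= t <= T -> (C `&` C') x ->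
    u (t, x) - v (t, x) <= A + 2 * L * `|x|.
  move=> tT [Cx C'x]; have t_ge0 : 0 <= t by case/andP: tT.
  have := u_lip t x 0 t_ge0 Cx C0; have := v_lip t x 0 t_ge0 C'x C'0.
  by have := uvA t tT; rewrite subr0 !ler_norml; lra.
pose KC := `[0, T]%classic `*` (C `&` [set x : H | `|x| <= rho]).
pose KC' := `[0, T]%classic `*` (C' `&` [set x : H | `|x| <= rho]).
(* Barrier and time penalty act on the first variable only, so the test function for [v] is purely
   quadratic. *)
pose f (w : (R * H) * (R * H)) := u w.1 - v w.2 -
  (M * barrier d V r w.1 + B * softpos d (w.1.1 - t0)).
pose p (w : (R * H) * (R * H)) := sqr_dist w.1 w.2.
pose I := [set w : R * H | 0 < w.1 < T /\ `|w.2| < rho].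
have K_compact : compact (KC `*` KC').
  by apply: compact_setX; exact: compact_cylinder.
have f_cont : {within KC `*` KC', continuous f}.
  have uc : {within KC `*` KC', continuous (fun w => u w.1)}.
    apply: within_continuous_fst; apply: continuous_subspaceW u_sub.1.
    exact: cylinder_nonneg_time.
  have vc : {within KC `*` KC', continuous (fun w => v w.2)}.
    apply: within_continuous_snd; apply: continuous_subspaceW v_super.1.
    exact: cylinder_nonneg_time.
  have bc : {within KC `*` KC', continuous (fun w => barrier d V r w.1)}.
    apply: continuous_subspaceT => w.
    apply: (@continuous_comp _ _ _ fst (barrier d V r)); first exact: cvg_fst.
    exact: barrier_continuous.
  have sc : {within KC `*` KC', continuous (fun w => softpos d (w.1.1 - t0))}.
    apply: continuous_subspaceT => w.
    apply: (@continuous_comp _ _ _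
      (fun w : (R * H) * (R * H) => w.1.1 - t0) (softpos d)).
      exact: (cvgB (cvg_comp _ _ cvg_fst cvg_fst) (cvg_cst _)).
    exact: softpos_continuous.
  move=> w; exact: (cvgB (cvgB (uc w) (vc w))
    (cvgD (cvgM (cvg_cst M) (bc w)) (cvgM (cvg_cst B) (sc w)))).
have p_cont : {within KC `*` KC', continuous p}.
  exact/continuous_subspaceT/sqr_dist_continuous.
have I_open : open I.
  have -> : I = `]0, T[%classic `*` [set x : H | `|x| < rho].
    by apply/seteqP; split => -[t x] [/= h1 h2]; split => //=; rewrite in_itv in h1 *.
  apply: open_setX; first exact: interval_open.
  apply: (@open_comp _ _ (fun x : H => `|x|) [set s | s < rho]); last exact: open_lt.
  by move=> x _; exact: norm_continuous.
(* On the diagonal the level [g] is not reached on the boundary: [F0] excludes time 0, the choice of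
   [B] excludes time [T], and that of [rho] excludes the sphere. *)
have diag w : KC w -> KC' w -> g <= f (w, w) -> I w.
  move=> [/= + [Cw w_rho]] [_ [C'w _]] gf; rewrite in_itv /= => t_itv.
  have /andP[t_ge0 t_leT] := t_itv.
  have /andP[b_ge _] := barrier_bounds d V r w d0.
  have /andP[s_ge _] := softpos_bounds d (w.1 - t0) d0.
  have Mb := ler_wpM2l (ltW M0) b_ge; have Bs := ler_wpM2l (ltW B0) s_ge.
  have {}gf : g <= F w - B * Num.max (w.1 - t0) 0 by move: gf; rewrite /f /F /=; lra.
  have mg : m < g by rewrite /g; lra.
  have Fw : F w <= A + M * r - (M - 2 * L) * `|w.2|.
    have := growth w.1 w.2 t_itv (conj Cw C'w); rewrite -surjective_pairing.
    have : `|w.2| - r <= Num.max (`|w.2| + V * w.1 - r) 0.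
      by rewrite le_max; apply/orP; left; have := mulr_ge0 V0 t_ge0; lra.
    by move=> /(ler_wpM2l (ltW M0)); rewrite /F; lra.
  have max_ge0 : 0 <= B * Num.max (w.1 - t0) 0.
    by rewrite mulr_ge0 ?(ltW B0)// le_max lexx orbT.
  split.
    rewrite !lt_neqAle t_ge0 t_leT !andbT; apply/andP; split; apply/eqP => tE.
      have := F0 w.2 (conj Cw C'w); rewrite [0]tE -surjective_pairing; lra.
    have : B <= B * Num.max (w.1 - t0) 0.
      by rewrite ler_peMr ?(ltW B0)// le_max tE /T addrAC subrr add0r lexx.
    have := ler_norm (A + M * r - m); rewrite /B in gf *.
    have : 0 <= (M - 2 * L) * `|w.2| by rewrite mulr_ge0// subr_ge0 ltW.
    lra.
  rewrite lt_neqAle w_rho andbT; apply/eqP => wE; rewrite wE in Fw; lra.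
have [] := @compact_penalization R _ (KC `*` KC') (I `*` I) f p g
  K_compact f_cont p_cont.
- exact: open_setX.
- by move=> w _; exact: sqr_dist_ge0.
- move=> [w w'] [/= Kw Kw'] /sqr_dist_eq0 /= ww'; rewrite -ww' in Kw' * => gf.
  by split => /=; exact: diag.
move=> a a0 ha.
pose w0 : (R * H) * (R * H) := ((t0, x0), (t0, x0)).
have Kw0 : (KC `*` KC') w0.
  have tT : t0 \in `[0, T] by rewrite in_itv /= t00 /T lerDl ler01.
  by case: Cx0 => Cx C'x; split; split => //; split => //=; exact: ltW.
(* On the diagonal the doubling term vanishes, and smoothing costs at most [(3 M + B) d / 2], half
   of the gap. *)
have fw0 : g <= f w0 - a * p w0.
  have /andP[_ b_le] := barrier_bounds d V r (t0, x0) d0.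
  have /andP[_] := softpos_bounds d (t0 - t0) d0; rewrite subrr maxxx add0r => s_le.
  have Mb := ler_wpM2l (ltW M0) b_le; have Bs := ler_wpM2l (ltW B0) s_le.
  rewrite /p /sqr_dist /= !subrr normr0 expr0n /= addr0 mul0r mulr0 subr0.
  rewrite /f /= subrr.
  move: dE; rewrite /g /F /= in Mb *; lra.
have pen_cont : {within KC `*` KC', continuous (fun w => f w - a * p w)}.
  move=> w; apply: cvgB; first exact: f_cont.
  by apply: cvgM; [exact: cvg_cst|exact: p_cont].
have [[z z'] zK hz] := compact_EVT_max (ex_intro _ w0 Kw0) K_compact pen_cont.
have {}hz y y' : KC y -> KC' y' ->
    f (y, y') - a * sqr_dist y y' <= f (z, z') - a * sqr_dist z z'.
  by move=> Ky Ky'; apply: hz (y, y') _; rewrite inE.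
move: zK; rewrite inE => -[/= Kz Kz'].
(* The maximal value is at least [g], so the choice of [a] makes the maximum interior. *)
have [Iz Iz'] : (I `*` I) (z, z').
  apply: ha => //; apply: le_trans fw0 _; exact: (hz (t0, x0) (t0, x0) Kw0.1 Kw0.2).
rewrite /f /= in hz.
apply: (no_interior_max C C' h u v L M a d B r t0 z z') => //.
- by case: Iz => /andP[? _] _; split => //; case: Kz => _ [].
- by case: Iz' => /andP[? _] _; split => //; case: Kz' => _ [].
- have Iz_nbhs : nbhs z I by exact: open_nbhs_nbhs.
  apply: (filterS _ Iz_nbhs) => w [/andP[wt0 wtT] wrho] [_ Cw] /=.
  have /(hz w z') /(_ Kz') : KC w.
    by split; [rewrite /= in_itv/= !ltW|split => //=; exact: ltW].
  by rewrite -/V; lra.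
- have Iz'_nbhs : nbhs z' I by exact: open_nbhs_nbhs.
  apply: (filterS _ Iz'_nbhs) => w [/andP[wt0 wtT] wrho] [_ Cw] /=.
  have /(hz z w Kz) : KC' w.
    by split; [rewrite /= in_itv/= !ltW|split => //=; exact: ltW].
  by rewrite (sqr_distC w) (sqr_distC z'); lra.
rewrite normrZ (gtr0_norm a0).
set n := `|z.2 - z'.2|; have n0 : 0 <= n by exact: normr_ge0.
have a_le k : 0 <= k -> a * (n ^+ 2 / 2) <= k * n -> a * n <= 2 * k.
  move=> k0; move: n0; rewrite le_eqVlt => /predU1P[<- _|n0].
    by rewrite mulr0 mulr_ge0.
  have -> : a * (n ^+ 2 / 2) = (a * n / 2) * n by ring.
  by rewrite ler_pM2r// => h1; lra.
have distE : sqr_dist z z' = (z.1 - z'.1) ^+ 2 / 2 + n ^+ 2 / 2.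
  by rewrite /sqr_dist mulrDl.
case: CC' => [CC'|C'C].
(* Moving the second space point to [z.2], at unchanged time, removes [a n^2 / 2] and changes only
   [v], by at most [L n]. *)
- apply: le_trans (a_le L L0 _) _; last by lra.
  have : KC' (z'.1, z.2).
    case: Kz Kz' => _ [Cz z_rho] [z'_itv _].
    by split => //; split => //; exact: CC'.
  move=> Ky; have := hz z _ Kz Ky.
  rewrite distE /sqr_dist /= subrr normr0 expr0n /= addr0.
  have /andP[z'1 _] : 0 <= z'.1 <= T by case: Kz' => /=; rewrite in_itv.
  have := v_lip z'.1 z.2 z'.2 z'1 Ky.2.1 Kz'.2.1; rewrite -surjective_pairing -/n.
  by rewrite ler_norml => /andP[_ vle]; lra.
(* Here the first space point moves to [z'.2]; both [u] and the barrier change, by at most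
   [(L + M) n] in all. *)
- apply: le_trans (a_le (L + M) (addr_ge0 L0 (ltW M0)) _) _; last by lra.
  have : KC (z.1, z'.2).
    case: Kz Kz' => z_itv _ [_ [C'z' z'_rho]].
    by split => //; split => //; exact: C'C.
  move=> Ky; have := hz _ z' Ky Kz'.
  rewrite distE /sqr_dist /= subrr normr0 expr0n /= addr0.
  have /andP[z1 _] : 0 <= z.1 <= T by case: Kz => /=; rewrite in_itv.
  have := u_lip z.1 z.2 z'.2 z1 Kz.2.1 Ky.2.1; rewrite -surjective_pairing -/n.
  have := barrier_lip d V r z.1 z.2 z'.2 d0; rewrite -surjective_pairing -/n.
  rewrite !ler_norml => /andP[ble _] /andP[_ ule].
  by have := ler_wpM2l (ltW M0) ble; lra.
Qed.
End Comparison.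

(** At time 0 the barrier outgrows [u - v], so a maximum over the initial slice is attained in a
    compact ball; [comparison] with this maximum as [m] then bounds the function at every later
    point. *)
Theorem proposition2p5 (R : realType) (H : finHilbertType R)
    (C C' : set H) (h : H -> R) (u v : R * H -> R) (L : R)
    (C_cone : closed_convex_cone C) (C'_cone : closed_convex_cone C')
    (C_gen : generates C) (C'_gen : generates C')
    (C_C' : C `<=` C' \/ C' `<=` C)
    (h_lip : locally_lipschitz h)
    (u_sub : viscosity_subsolution C h u)
    (v_super : viscosity_supersolution C' h v)
    (L_def : L%:E = lip_sup C C' u v)
    (r M : R) (r_gt0 : 0 < r) (M_gt : 2 * L < M) :
  let V := ball_lip h (2 * L + 3 * M) in
  achieves_sup_on (nonneg_time (C `&` C')) [set z | z.1 = 0]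
    (fun z => u z - v z - M * Num.max (`|z.2| + V * z.1 - r) 0).
Proof.
move=> V; pose F z := u z - v z - M * Num.max (`|z.2| + V * z.1 - r) 0.
have [L0 u_lip v_lip] := lip_supP C C' u v L L_def.
have C0 := generating_cone0 C C_cone C_gen.
have C'0 := generating_cone0 C' C'_cone C'_gen.
have CC'_closed : closed (C `&` C').
  by apply: closedI; [case: C_cone|case: C'_cone].
have uv_cont : {within nonneg_time (C `&` C'), continuous (fun z => u z - v z)}.
  have uc : {within nonneg_time (C `&` C'), continuous u}.
    by apply: continuous_subspaceW u_sub.1 => z [? []].
  have vc : {within nonneg_time (C `&` C'), continuous v}.
    by apply: continuous_subspaceW v_super.1 => z [? []].
  by move=> z; exact: (cvgB (uc z) (vc z)).
have F_cont : {within nonneg_time (C `&` C'), continuous F}.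
  have mc : continuous (fun z : R * H => Num.max (`|z.2| + V * z.1 - r) 0).
    move=> z; apply: (@continuous_max _ _
      (fun z : R * H => `|z.2| + V * z.1 - r) (fun=> 0)).
      exact: (cvgB (cvgD (cvg_norm cvg_snd) (cvgM (cvg_cst V) cvg_fst))
        (cvg_cst r)).
    exact: cvg_cst.
  have mc' : {within nonneg_time (C `&` C'),
      continuous (fun z : R * H => Num.max (`|z.2| + V * z.1 - r) 0)}.
    exact: continuous_subspaceT.
  by move=> z; exact: (cvgB (uv_cont z) (cvgM (cvg_cst M) (mc' z))).
have cyl_sub T rho :=
  @cylinder_nonneg_time R H (C `&` C') (C `&` C') T rho (fun _ => id).
(* For [|x| > rho] the term [M (|x| - r)] exceeds the possible growth [2 L |x|], so the value at
   [(0, x)] is at most that at the origin, where the barrier vanishes. *)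
pose rho := M * r / (M - 2 * L).
have ML : 0 < M - 2 * L by lra.
have rho0 : 0 <= rho by rewrite divr_ge0 ?ltW// mulr_gt0//; lra.
pose K := `[(0 : R), 0]%classic `*` (C `&` C' `&` [set x : H | `|x| <= rho]).
have K0 : K (0, 0).
  by split; [rewrite /= in_itv /= lexx|split => //=; rewrite normr0].
have [z0 z0K z0_max] := compact_EVT_max (ex_intro _ _ K0)
  (compact_cylinder (C `&` C') 0 rho CC'_closed)
  (continuous_subspaceW (cyl_sub 0 rho) F_cont).
move: z0K; rewrite inE => -[/= z01 [CC'z0 _]].
have {}z01 : z0.1 = 0.
  by move: z01; rewrite in_itv /= => /andP[? ?]; apply/eqP; rewrite eq_le; apply/andP.
have F_initial x : (C `&` C') x -> F (0, x) <= F z0.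
  move=> CC'x; have [x_rho|x_rho] := leP `|x| rho.
    by apply: z0_max; rewrite inE; split => //=; rewrite in_itv /= lexx.
  apply: le_trans (z0_max (0, 0) _); last by rewrite inE.
  case: CC'x => Cx C'x.
  have := u_lip 0 x 0 (lexx _) Cx C0; have := v_lip 0 x 0 (lexx _) C'x C'0.
  rewrite subr0 !ler_norml /F /= normr0 mulr0 !addr0.
  have -> : Num.max (0 - r) 0 = 0 by apply: max_r; lra.
  have : M * (`|x| - r) <= M * Num.max (`|x| - r) 0.
    by rewrite ler_wpM2l ?le_max ?lexx//; lra.
  have : M * r < (M - 2 * L) * `|x| by rewrite -ltr_pdivrMl// mulrC.
  by lra.
exists z0; first by split => //; split => //; rewrite /= z01.
move=> [t x] [/= t0 CC'x].
(* The cylinder of radius 0 is the time segment at the origin; the maximum of [u - v] on it serves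
   as [A]. *)
have K'0 : (`[0, t + 1]%classic `*` (C `&` C' `&` [set y : H | `|y| <= 0])) (0, 0).
  by split; [rewrite /= in_itv /= lexx addr_ge0|split => //=; rewrite normr0].
have [z1 _ z1_max] := compact_EVT_max (ex_intro _ _ K'0)
  (compact_cylinder (C `&` C') (t + 1) 0 CC'_closed)
  (continuous_subspaceW (cyl_sub (t + 1) 0) uv_cont).
apply: (comparison C C' h u v L M r (F z0) (u z1 - v z1) t x) => //.
move=> s s_itv; apply: (z1_max (s, 0)); rewrite inE; split.
  by rewrite /= in_itv.
by split => //=; rewrite normr0.
Qed.
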